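(* Let $G=(V,E)$ be a graph with $n$ vertices and nonnegative edge lengths $c_e$, let $r\in V$ be a root and let $k$ be an integer with $0\le k\le n-1$. Define the weights $\phi(r)=n^2$ and $\phi(v)=1$ for all $v\in V\setminus\{r\}$, and let $S=(n^2+k)^2$. Then the rooted $k$-MST instance $(G,c,r,k)$ is equivalent to the $S$-MPCSF instance $(G,c,\phi,S)$: every tree containing $r$ and at least $k$ other vertices yields a forest of the same cost collecting prize at least $S$, and for every forest collecting prize at least $S$, its connected component containing $r$ is a tree containing $r$ and at least $k$ other vertices. In particular the optimal values of the two instances coincide.
   Context: Rooted $k$-MST: given a graph with nonnegative edge lengths, a root $r$ and an integer $k$, find a minimum-cost tree containing $r$ and at least $k$ vertices other than $r$ (cost is the sum of edge lengths). $S$-MPCSF on a graph: given nonnegative vertex weights $\phi$ and a number $S$, find a minimum-cost forest $F\subseteq E$ whose collected prize $\sum\phi(u)\phi(v)$, summed over all ordered pairs $(u,v)\in V\times V$ with $u=v$ or $u,v$ in the same connected component of $F$, is at least $S$. *)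

(* Defs.v *)
From mathcomp Require Import all_boot all_order all_algebra.
From mathcomp Require Import boolp constructive_ereal.

Set Implicit Arguments.
Unset Strict Implicit.
Unset Printing Implicit Defensive.

Import Order.TTheory GRing.Theory Num.Theory.

Local Open Scope ring_scope.

(* A finite simple graph with vertex type V is given by its edge set
   E : {set {set V}}, an edge being an unordered pair of distinct vertices. *)
Definition simple_graph (V : finType) (E : {set {set V}}) : Prop :=
  forall e : {set V}, e \in E -> #|e| = 2%N.

Definition adj (V : finType) (F : {set {set V}}) : rel V :=
  [rel u v | [set u; v] \in F].

(* [ucycle] lists distinct vertices, each adjacent to the next and the last to
   the first; a graph cycle is such a list with at least three vertices (the
   closed walk u v u along a single edge has size 2 and does not count). *)
Definition acyclic (V : finType) (F : {set {set V}}) : Prop :=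
  forall p : seq V, ucycle (adj F) p -> (size p <= 2)%N.

Definition is_forest (V : finType) (E F : {set {set V}}) : Prop :=
  F \subset E /\ acyclic F.

(* Subgraphs are pairs (vertex set, edge set). The vertex set is needed because
   the edge set alone does not determine a one-vertex tree. *)
Notation subgraph V := ({set V} * {set {set V}})%type.

Definition is_tree (V : finType) (E : {set {set V}}) (T : subgraph V) : Prop :=
  [/\ T.1 != set0,
      T.2 \subset E,
      forall e : {set V}, e \in T.2 -> e \subset T.1,
      forall u v : V, u \in T.1 -> v \in T.1 -> connect (adj T.2) u v
    & acyclic T.2].

Definition component (V : finType) (F : {set {set V}}) (r : V) : subgraph V :=
  let W := [set v | connect (adj F) r v] in
  (W, [set e in F | e \subset W]).

Definition cost (R : realFieldType) (V : finType) (c : {set V} -> R)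
    (F : {set {set V}}) : R :=
  \sum_(e in F) c e.

Definition kmst_feasible (V : finType) (E : {set {set V}}) (r : V) (k : nat)
    (T : subgraph V) : Prop :=
  [/\ is_tree E T, r \in T.1 & (k <= #|T.1 :\ r|)%N].

(* The sum ranges over ordered pairs; vertices not covered by F are singleton
   components. *)
Definition prize (R : realFieldType) (V : finType) (phi : V -> R)
    (F : {set {set V}}) : R :=
  \sum_(p : V * V | (p.1 == p.2) || connect (adj F) p.1 p.2)
     phi p.1 * phi p.2.

Definition mpcsf_feasible (R : realFieldType) (V : finType)
    (E : {set {set V}}) (phi : V -> R) (S : R) (F : {set {set V}}) : Prop :=
  is_forest E F /\ S <= prize phi F.

(* Optimal values are minima over finitely many solutions, in the extended
   reals: the value is +oo exactly when the instance is infeasible (this can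
   happen, as the graph is not assumed connected). *)
Definition kmst_opt (R : realFieldType) (V : finType) (E : {set {set V}})
    (c : {set V} -> R) (r : V) (k : nat) : \bar R :=
  \big[Order.min/+oo%E]_(T : subgraph V | `[< kmst_feasible E r k T >])
     (cost c T.2)%:E.

Definition mpcsf_opt (R : realFieldType) (V : finType) (E : {set {set V}})
    (c : {set V} -> R) (phi : V -> R) (S : R) : \bar R :=
  \big[Order.min/+oo%E]_(F : {set {set V}} | `[< mpcsf_feasible E phi S F >])
     (cost c F)%:E.

(* Main.v *)
(** The root weight dominates: a component containing [r] and [w] other vertices
    collects [(n^2 + w)^2], while all the other components together collect at
    most [(n - 1 - w)^2 < 2 n^2].  Hence if [w < k], the total prize stays below
    [(n^2 + w)^2 + 2 n^2 <= (n^2 + k)^2]. *)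

Require Import Defs.
From mathcomp Require Import all_boot all_order all_algebra.
From mathcomp Require Import boolp constructive_ereal.
From mathcomp Require Import zify.

Import Order.TTheory GRing.Theory Num.Theory.

Local Open Scope ring_scope.

Set Implicit Arguments.
Unset Strict Implicit.

Lemma adj_sym (V : finType) (F : {set {set V}}) : symmetric (adj F).
Proof. by move=> u v; rewrite /adj /= setUC. Qed.

Lemma acyclic_subset (V : finType) (F F' : {set {set V}}) :
  F' \subset F -> acyclic F -> acyclic F'.
Proof.
move=> /subsetP sF acF p /andP[cp up]; apply: acF; rewrite /ucycle up andbT.
by apply: sub_cycle cp => u v /sF.
Qed.

Lemma component_root (V : finType) (F : {set {set V}}) (r : V) :
  r \in (component F r).1.
Proof. by rewrite inE connect0. Qed.

Lemma component_connect (V : finType) (F : {set {set V}}) (r u v : V) :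
  connect (adj F) u v ->
  (u \in (component F r).1) = (v \in (component F r).1).
Proof.
move=> uv; rewrite !inE; apply/idP/idP => [ru|rv]; first exact: connect_trans uv.
by apply: connect_trans rv _; rewrite sym_connect_sym //; exact: adj_sym.
Qed.

Lemma component_edges (V : finType) (F : {set {set V}}) (r : V) :
  (component F r).2 \subset F.
Proof. by apply/subsetP => e; rewrite inE => /andP[]. Qed.

(** Every vertex of a path from [r] is itself reachable from [r], so no edge of the path leaves the
    component. Induction removes the last vertex, so that the prefix still starts at [r]. *)
Lemma connect_component (V : finType) (F : {set {set V}}) (r v : V) :
  v \in (component F r).1 -> connect (adj (component F r).2) r v.
Proof.
rewrite inE => /connectP[p + ->].
elim/last_ind: p => [|p x IHp] /=; first by rewrite connect0.
rewrite rcons_path last_rcons => /andP[rp lx].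
apply: connect_trans (IHp rp) (connect1 _).
have rl : connect (adj F) r (last r p) by apply/connectP; exists p.
rewrite /adj /= inE; apply/andP; split=> //.
by rewrite subUset !sub1set !inE rl (connect_trans rl (connect1 lx)).
Qed.

Lemma component_is_tree (V : finType) (E F : {set {set V}}) (r : V) :
  is_forest E F -> is_tree E (component F r).
Proof.
move=> [sFE acF]; split.
- by apply/set0Pn; exists r; exact: component_root.
- exact: subset_trans (component_edges F r) sFE.
- by move=> e; rewrite inE => /andP[].
- move=> u v /connect_component ru /connect_component rv.
  by apply: connect_trans rv; rewrite sym_connect_sym //; exact: adj_sym.
- exact: acyclic_subset (component_edges F r) acF.
Qed.

Lemma cost_subset (R : realFieldType) (V : finType) (c : {set V} -> R)
    (F F' : {set {set V}}) :
  (forall e, e \in F -> 0 <= c e) -> F' \subset F -> cost c F' <= cost c F.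
Proof.
move=> c0 /subsetP sF; rewrite /cost big_mkcond [leRHS]big_mkcond /=.
apply: ler_sum => e _; case: ifP => [/sF ->//|_].
by case: ifP => // /c0.
Qed.

Lemma sqr_sum_setX (R : realFieldType) (V : finType) (phi : V -> R)
    (A : {set V}) :
  (\sum_(v in A) phi v) ^+ 2 =
  \sum_(p : V * V | (p.1 \in A) && (p.2 \in A)) phi p.1 * phi p.2.
Proof. by rewrite expr2 big_distrlr /= pair_big. Qed.

(** The square expands into the products over [A * A]; all these pairs are counted in the prize, and
    its other terms are nonnegative. *)
Lemma prize_ge_connected (R : realFieldType) (V : finType) (phi : V -> R)
    (F : {set {set V}}) (A : {set V}) :
  (forall v, 0 <= phi v) ->
  (forall u v, u \in A -> v \in A -> connect (adj F) u v) ->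
  (\sum_(v in A) phi v) ^+ 2 <= prize phi F.
Proof.
move=> phi0 cA; rewrite sqr_sum_setX /prize big_mkcond [leRHS]big_mkcond /=.
apply: ler_sum => -[u v] _ /=; case: ifP => [/andP[uA vA]|_].
  by rewrite cA // orbT.
by case: ifP => // _; rewrite mulr_ge0.
Qed.

(** No counted pair has one end in [W] and the other outside. The bound treats the vertices outside
    [W] as if they formed a single component, which can only add nonnegative terms. *)
Lemma prize_le_component (R : realFieldType) (V : finType) (phi : V -> R)
    (F : {set {set V}}) (r : V) (W := (component F r).1) :
  (forall v, 0 <= phi v) ->
  prize phi F <=
  (\sum_(v in W) phi v) ^+ 2 + (\sum_(v in ~: W) phi v) ^+ 2.
Proof.
move=> phi0; rewrite !sqr_sum_setX /prize big_mkcond.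
rewrite [X in _ <= X + _]big_mkcond [X in _ <= _ + X]big_mkcond -big_split /=.
apply: ler_sum => -[u v] _ /=; rewrite !in_setC.
have phi2 : 0 <= phi u * phi v by rewrite mulr_ge0.
(* A pair that is not counted contributes 0 on the left. A counted one has both ends on the same
   side of [W], so exactly one of the two squares contains its product. *)
case: ifP => [uv|_]; last by case: ifP; case: ifP; rewrite ?addr0 ?addr_ge0.
have -> : (u \in W) = (v \in W).
  by case/orP: uv => [/eqP->|/component_connect uv] //; exact: uv.
by case: (v \in W); rewrite /= ?addr0 ?add0r.
Qed.

Lemma sum_root_weight (R : realFieldType) (V : finType) (r : V) (x : R)
    (A : {set V}) :
  r \in A ->
  \sum_(v in A) (if v == r then x else 1) = x + #|A :\ r|%:R.
Proof.
move=> rA; rewrite (big_setD1 r) //= eqxx -sumr_const; congr (_ + _).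
by apply: eq_bigr => v; rewrite !inE => /andP[/negPf->].
Qed.

Lemma sum_nonroot_weight (R : realFieldType) (V : finType) (r : V) (x : R)
    (A : {set V}) :
  r \notin A -> \sum_(v in A) (if v == r then x else 1) = #|A|%:R.
Proof.
move=> rA; rewrite -sumr_const; apply: eq_bigr => v vA.
by case: eqP => // vr; rewrite -vr vA in rA.
Qed.

(** Raising [w] by one already increases the first square by [2 * (n ^ 2 + w) + 1], which exceeds
    [m ^ 2]. Here [m] stands for the number of vertices outside the component of the root. *)
Lemma small_component_prize (n k w m : nat) :
  (w < k)%N -> (m < n)%N ->
  ((n ^ 2 + w) ^ 2 + m ^ 2 < (n ^ 2 + k) ^ 2)%N.
Proof.
move=> wk mn; have mn2 : (m ^ 2 < n ^ 2)%N by rewrite ltn_exp2r.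
apply: (@leq_trans ((n ^ 2 + w.+1) ^ 2)); last by rewrite leq_exp2r // leq_add2l.
by move: (n ^ 2)%N mn2 => N; nia.
Qed.

Unset Implicit Arguments.
Set Strict Implicit.

Theorem theorem8 (R : realFieldType) (V : finType) (E : {set {set V}})
    (c : {set V} -> R) (r : V) (n k : nat)
    (hE : simple_graph E)
    (hn : #|V| = n)
    (hc : forall e : {set V}, e \in E -> 0 <= c e)
    (hk : (k <= n - 1)%N) :
  let phi : V -> R := fun v => if v == r then n%:R ^+ 2 else 1 in
  let S : R := (n%:R ^+ 2 + k%:R) ^+ 2 in
  [/\ forall T : subgraph V, kmst_feasible E r k T ->
        exists F : {set {set V}},
          mpcsf_feasible E phi S F /\ cost c F = cost c T.2,
      forall F : {set {set V}}, mpcsf_feasible E phi S F ->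
        kmst_feasible E r k (component F r)
    & kmst_opt E c r k = mpcsf_opt E c phi S].
Proof.
move=> phi S.
have phi0 v : 0 <= phi v by rewrite /phi; case: ifP; rewrite ?exprn_ge0.
have tree_forest T : kmst_feasible E r k T -> mpcsf_feasible E phi S T.2.
  move=> [[_ sTE _ cT acT] rT kT]; split=> //.
  (* The pairs inside the vertex set of the tree suffice: their prize is the square of [n ^ 2] plus
     the number of non-root vertices. *)
  apply: le_trans (prize_ge_connected _ cT) => //.
  rewrite /phi sum_root_weight // lerXn2r ?nnegrE ?addr_ge0 ?exprn_ge0 //.
  by rewrite lerD2l ler_nat.
have forest_tree F : mpcsf_feasible E phi S F ->
    kmst_feasible E r k (component F r).
  move=> [fF SF]; have rW := component_root F r.
  split=> //; first exact: component_is_tree.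
  rewrite leqNgt; apply/negP => wk.
  have: S <= _ := le_trans SF (prize_le_component F r phi0).
  rewrite /phi sum_root_weight // sum_nonroot_weight ?in_setC ?rW // /S.
  (* All quantities are casts of naturals, so the contradiction is sought in [nat]. *)
  rewrite -!natrX -!natrD -!natrX -natrD ler_nat leqNgt => /negP; apply.
  apply: small_component_prize => //.
  (* The complement has fewer than [n] vertices because it misses [r]. *)
  by rewrite -hn -(cardsC (component F r).1) -[ltnLHS]add0n ltn_add2r (cardD1 r) rW.
split=> //; first by move=> T fT; exists T.2; split=> //; exact: tree_forest.
rewrite /kmst_opt /mpcsf_opt; apply: le_anti; apply/andP; split.
(* Passing to the root component only drops edges of nonnegative length. The default [+oo] covers
   the infeasible case. *)
- apply/bigmin_geP; split=> [|F /asboolP fF]; first exact: leey.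
  apply: (@bigmin_inf _ _ _ _ (component F r)).
    by apply/asboolP; exact: forest_tree.
  rewrite lee_fin; apply: cost_subset (component_edges F r) => e eF.
  by case: fF => -[/subsetP sFE _] _; apply: hc; exact: sFE.
- apply/bigmin_geP; split=> [|T /asboolP fT]; first exact: leey.
  by apply: (@bigmin_inf _ _ _ _ T.2) => //; apply/asboolP; exact: tree_forest.
Qed.
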